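(* Let $\phi$ be a bimodal formula. Then $\phi$ is projective in the logic $\mathbf{J}_2$ if and only if the class $MOD_S(\phi)$ of its stratified models has the extension property.
   Context: Language: propositional variables from a fixed finite list $\vec p=(p_1,\dots,p_k)$ (all formulas considered use only these variables), constants $\top,\bot$, Boolean connectives, and modalities $[0],[1]$; $\langle i\rangle$ abbreviates $\neg[i]\neg$. The logic $\mathbf{J}_2$ has as axioms all Boolean tautologies, $[i](\phi\to\psi)\to([i]\phi\to[i]\psi)$ and $[i]([i]\phi\to\phi)\to[i]\phi$ for $i=0,1$, $[m]\phi\to[n][m]\phi$ and $[m]\phi\to[m][n]\phi$ for $m\le n$, and $\langle 0\rangle\phi\to[1]\langle 0\rangle\phi$; its rules are modus ponens and $\phi/[i]\phi$ for $i=0,1$. $\vdash_{\mathbf{J}_2}\chi$ means $\chi$ is a theorem; $\psi\vdash_{\mathbf{J}_2}\chi$ means $\chi$ is derivable from the axioms together with $\psi$ using these rules (including necessitation). A (finite) stratified model is $\mathcal W=\langle W,R_0,R_1,v\rangle$ with $W$ finite nonempty, $R_0,R_1$ irreflexive transitive relations on $W$, $v$ assigning to each variable a subset of $W$, such that: (a) if $xR_1y$ then for all $z$, $xR_0z\iff yR_0z$; (b) if $m\le n$, $xR_my$ and $yR_nz$ then $xR_mz$; (c) if $zR_0x$ and $yR_1x$ then $zR_0y$. Truth $\mathcal W,x\Vdash\phi$ is the usual Kripke truth ($[i]\phi$ true at $x$ iff $\phi$ true at all $R_i$-successors of $x$). $\mathcal W\vDash\phi$ means $\phi$ is true at every world.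 For $x\in W$, $\mathcal W_x$ is the submodel generated by $x$ (the least set containing $x$ closed under $R_0,R_1$-successors), with root $x$. Throughout, ''model'' means a finite stratified model with a root $r$ (i.e. $\mathcal W=\mathcal W_r$). $MOD_S(\phi)$ is the class of models $\mathcal W$ with $\mathcal W\vDash\phi$. A substitution $\sigma$ assigns to each $p_i$ a formula; $\sigma(\phi)$ is the result of simultaneously replacing each $p_i$ by $\sigma(p_i)$. A unifier of $\phi$ is a substitution $\sigma$ with $\vdash_{\mathbf{J}_2}\sigma(\phi)$. $\phi$ is projective in $\mathbf{J}_2$ if it has a unifier $\sigma$ with $\phi\vdash_{\mathbf{J}_2}\sigma(p)\leftrightarrow p$ for every $p\in\vec p$. A variant of a model $\mathcal W=\langle W,R_0,R_1,r,v\rangle$ (with root $r$) is a model $\langle W,R_0,R_1,r,v'\rangle$ on the same frame with the same root such that every world $x\neq r$ satisfies exactly the same variables under $v$ and $v'$. A class $K$ of models has the extension property if for every model $\mathcal W$ with root $r$ such that $\mathcal W_x\in K$ for all worlds $x\ne r$, some variant of $\mathcal W$ belongs to $K$. *)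

(* Defs.v *)
From HB Require Import structures.
From mathcomp Require Import all_boot.

Set Implicit Arguments.
Unset Strict Implicit.
Unset Printing Implicit Defensive.

Inductive form (k : nat) : Type :=
| Var of 'I_k
| Top
| Bot
| Neg of form k
| And of form k & form k
| Or of form k & form k
| Imp of form k & form k
| Box of 'I_2 & form k.

Arguments Top {k}.
Arguments Bot {k}.

Definition Iff k (A B : form k) : form k := And (Imp A B) (Imp B A).
Definition Dia k (i : 'I_2) (A : form k) : form k := Neg (Box i (Neg A)).

Notation i0 := (@ord0 1).
Notation i1 := (@ord_max 1).

Definition substitution (k : nat) : Type := 'I_k -> form k.

Fixpoint subst k (s : substitution k) (A : form k) : form k :=
  match A with
  | Var p => s p
  | Top => Top
  | Bot => Bot
  | Neg B => Neg (subst s B)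
  | And B C => And (subst s B) (subst s C)
  | Or B C => Or (subst s B) (subst s C)
  | Imp B C => Imp (subst s B) (subst s C)
  | Box i B => Box i (subst s B)
  end.

(* Classical evaluation in which variables and boxed formulas are the atoms,
   so that [tautology] covers all substitution instances of propositional
   tautologies. *)
Fixpoint bool_eval k (a : form k -> bool) (A : form k) : bool :=
  match A with
  | Var _ | Box _ _ => a A
  | Top => true
  | Bot => false
  | Neg B => ~~ bool_eval a B
  | And B C => bool_eval a B && bool_eval a C
  | Or B C => bool_eval a B || bool_eval a C
  | Imp B C => bool_eval a B ==> bool_eval a C
  end.

Definition tautology k (A : form k) : Prop :=
  forall a : form k -> bool, bool_eval a A.

Inductive J2_axiom k : form k -> Prop :=
| ax_taut A of tautology A : J2_axiom A
| ax_K (i : 'I_2) A B :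
    J2_axiom (Imp (Box i (Imp A B)) (Imp (Box i A) (Box i B)))
| ax_Lob (i : 'I_2) A : J2_axiom (Imp (Box i (Imp (Box i A) A)) (Box i A))
| ax_box_nm (m n : 'I_2) A of m <= n : J2_axiom (Imp (Box m A) (Box n (Box m A)))
| ax_box_mn (m n : 'I_2) A of m <= n : J2_axiom (Imp (Box m A) (Box m (Box n A)))
| ax_dia A : J2_axiom (Imp (Dia i0 A) (Box i1 (Dia i0 A))).

(* Global consequence: necessitation also applies to formulas that depend on
   the hypotheses. *)
Inductive J2_derives k (hyp : form k -> Prop) : form k -> Prop :=
| d_hyp A of hyp A : J2_derives hyp A
| d_ax A of J2_axiom A : J2_derives hyp A
| d_mp A B of J2_derives hyp (Imp A B) & J2_derives hyp A : J2_derives hyp B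
| d_nec (i : 'I_2) A of J2_derives hyp A : J2_derives hyp (Box i A).

Definition J2_theorem k (A : form k) : Prop := J2_derives (fun=> False) A.
Definition J2_entails k (A B : form k) : Prop := J2_derives (eq A) B.

Definition unifier k (s : substitution k) (A : form k) : Prop :=
  J2_theorem (subst s A).

Definition projective k (A : form k) : Prop :=
  exists2 s : substitution k, unifier s A &
    forall p : 'I_k, J2_entails A (Iff (s p) (Var p)).

Definition step (W : finType) (R : 'I_2 -> rel W) : rel W :=
  [rel x y | [exists i, R i x y]].

(* Finite rooted stratified frames. The worlds of the subframe generated by x
   are those related to x by [connect (step R)], so [root_gen] says that the
   frame is generated by its root. *)
Record frame : Type := Frame {
  world :> finType;
  R : 'I_2 -> rel world;
  root : world;
  R_irr : forall i, irreflexive (R i);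
  R_trans : forall i, transitive (R i);
  R1_R0 : forall x y, R i1 x y -> forall z, R i0 x z <-> R i0 y z;
  R_mn : forall (m n : 'I_2) x y z, m <= n -> R m x y -> R n y z -> R m x z;
  R_strat : forall x y z, R i0 z x -> R i1 y x -> R i0 z y;
  root_gen : forall x, connect (step R) root x }.

Record model (k : nat) : Type := Model {
  mframe :> frame;
  val_of : 'I_k -> {set mframe} }.

Fixpoint sat k (M : model k) (x : M) (A : form k) : bool :=
  match A with
  | Var p => x \in val_of M p
  | Top => true
  | Bot => false
  | Neg B => ~~ sat x B
  | And B C => sat x B && sat x C
  | Or B C => sat x B || sat x C
  | Imp B C => sat x B ==> sat x C
  | Box i B => [forall y : M, R i x y ==> sat y B]
  end.

Definition valid_in k (M : model k) (A : form k) : Prop := forall x : M, sat x A.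

Section GeneratedSubmodel.
Variables (F : frame) (x : F).

Definition gen_world : finType := {y : F | connect (step (@R F)) x y}.
Definition gen_R (i : 'I_2) : rel gen_world := [rel y z | R i (val y) (val z)].
Definition gen_root : gen_world := Sub x (connect0 _ x).

Lemma gen_R_irr i : irreflexive (gen_R i).
Proof. by move=> y; apply: R_irr. Qed.

Lemma gen_R_trans i : transitive (gen_R i).
Proof. by move=> y z t; apply: R_trans. Qed.

Lemma gen_R1_R0 y z : gen_R i1 y z -> forall t, gen_R i0 y t <-> gen_R i0 z t.
Proof. by move=> yz t; apply: R1_R0. Qed.

Lemma gen_R_mn (m n : 'I_2) y z t :
  m <= n -> gen_R m y z -> gen_R n z t -> gen_R m y t.
Proof. exact: R_mn. Qed.

Lemma gen_R_strat y z t : gen_R i0 t y -> gen_R i1 z y -> gen_R i0 t z.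
Proof. exact: R_strat. Qed.

Lemma gen_root_gen y : connect (step gen_R) gen_root y.
Proof.
case: y => y xy; have /connectP[p] := xy.
elim/last_ind: p y xy => [|p z IHp] y xy /=.
  by move=> _ yx; have -> : exist _ y xy = gen_root by apply: val_inj.
rewrite rcons_path last_rcons => /andP[xp pz] yz.
have xl : connect (step (@R F)) x (last x p) by apply/connectP; exists p.
apply: connect_trans (IHp _ xl xp erefl) (connect1 _).
by case/existsP: pz => i pz; apply/existsP; exists i; rewrite /gen_R /= yz.
Qed.

Definition gen_frame : frame :=
  Frame gen_R_irr gen_R_trans gen_R1_R0 gen_R_mn gen_R_strat gen_root_gen.

End GeneratedSubmodel.

Definition gen_submodel k (M : model k) (x : M) : model k :=
  @Model k (gen_frame x) (fun p => [set y : gen_world x | val y \in val_of M p]).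

Definition variant k (M M' : model k) : Prop :=
  exists2 v : 'I_k -> {set M},
    forall (x : M) (p : 'I_k), x != root M -> (x \in v p) = (x \in val_of M p) &
    M' = Model v.

Definition extension_property k (K : model k -> Prop) : Prop :=
  forall M : model k,
    (forall x : M, x != root M -> K (gen_submodel x)) ->
    exists2 M' : model k, variant M M' & K M'.

Definition MOD_S k (A : form k) : model k -> Prop := fun M => valid_in M A.

(* Main.v *)
From HB Require Import structures.
From mathcomp Require Import all_boot.
From mathcomp Require Import boolp.
Require Import Defs.

Set Implicit Arguments.
Unset Strict Implicit.
Unset Printing Implicit Defensive.

(** If [s] is a projective unifier, evaluating [s] in a model turns it into a
   variant in which the formula [phi] holds.

   Conversely, work on a model from the leaves down to the root: keep the worlds
   at which [phi] holds hereditarily, and give every other world a valuation of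
   the variables that makes [phi] true. By the extension property one exists,
   and it may be chosen as a Boolean function of the truth values, in the new
   model, of the boxed subformulas of [phi]. The new values of these boxes solve
   a modalized fixed-point system, which has a solution by formulas: a single
   equation [X <-> [j] C(X)] is solved by [[j] C(Top)] as long as [X] occurs in
   [C] only under modalities that are at least [j], so all the unknowns can be
   eliminated, those boxed by [1] first.

   The unifier found in this way is provable by completeness of J_2 for finite
   stratified models. The canonical frame satisfies all the frame conditions but
   the last one, which is obtained by making disjoint copies of the upsets
   of [R i1]. *)

(** * Formula equality and induction on finite orders *)

Lemma form_comparable k : comparable (form k).
Proof. by move=> A B; rewrite /decidable; decide equality; apply: eq_comparable. Qed.

HB.instance Definition _ k := comparableMixin (@form_comparable k).

Lemma ord2P (i : 'I_2) : i = i0 \/ i = i1.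
Proof. by case: i => -[|[|//]] ?; [left | right]; apply: val_inj. Qed.

Lemma finite_order_ind (T : finType) (r : rel T) (P : T -> Prop) :
  irreflexive r -> transitive r ->
  (forall x, (forall y, r x y -> P y) -> P x) -> forall x, P x.
Proof.
move=> irr tr IH x; have [n] := ubnP #|[set y | r x y]|.
elim: n x => // n IHn x /ltnSE le_n; apply: IH => y xy; apply: IHn.
apply: leq_trans le_n; apply: proper_card; apply/properP; split.
  by apply/subsetP => z; rewrite !inE; apply: tr.
by exists y; rewrite inE // irr.
Qed.

(** * Composition of steps in stratified frames *)

Section Frames.
Variable F : frame.
Implicit Types x y z : F.

Lemma R10 x y z : R i1 x y -> R i0 y z -> R i0 x z.
Proof. by move=> xy yz; apply/(R1_R0 xy). Qed.

(** The composite is a step for the smaller modality: this is [R_mn] if [i <= j], and [R10] in the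
    one remaining case, [R i1] followed by [R i0]. *)
Lemma R_comp i j x y z : R i x y -> R j y z -> step (@R F) x z.
Proof.
move=> xy yz; apply/existsP; have [le_ij|lt_ji] := leqP i j.
  by exists i; apply: R_mn xy yz.
exists j; case: (ord2P i) (ord2P j) lt_ji xy yz => -> [] -> // _; exact: R10.
Qed.

Lemma step_irr : irreflexive (step (@R F)).
Proof. by move=> x; apply/existsP => -[i]; rewrite R_irr. Qed.

Lemma step_trans : transitive (step (@R F)).
Proof. by move=> y x z /existsP[i xy] /existsP[j]; apply: R_comp xy. Qed.

Lemma connect_stepE x y : connect (step (@R F)) x y = (x == y) || step (@R F) x y.
Proof.
apply/idP/orP => [|[/eqP->//|/connect1//]].
case/connectP=> p; elim: p x => [|z p IHp] x /=; first by move=> _ ->; left.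
case/andP=> xz /IHp IH /IH [/eqP<-|]; right=> //; exact: step_trans xz _.
Qed.

(** The root reaches every world, so a step into it would close a cycle. *)
Lemma step_rootF x : ~~ step (@R F) x (root F).
Proof.
apply/negP => xr; have := root_gen x; rewrite connect_stepE.
case/orP=> [/eqP rx|rx]; first by rewrite -rx step_irr in xr.
by have := step_trans rx xr; rewrite step_irr.
Qed.

(* The worlds on which the truth at [x] of a formula depends when all its
   modalities are at least [j]. *)
Definition cone (j : 'I_2) : rel F :=
  fun x y => (x == y) || [exists i : 'I_2, (j <= i) && R i x y].

Lemma cone_refl j : reflexive (cone j).
Proof. by move=> x; rewrite /cone eqxx. Qed.

Lemma R_cone j x y z : R j x y -> cone j y z -> R j x z.
Proof.
move=> xy /orP[/eqP<-//|/existsP[i /andP[ji yz]]]; exact: R_mn xy yz.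
Qed.

Lemma cone_R j x y z : cone j x y -> R j y z -> R j x z.
Proof.
case/orP=> [/eqP->//|/existsP[i /andP[]]].
by case: (ord2P i) (ord2P j) => -> [] -> // _; [| exact: R10 |]; apply: R_trans.
Qed.

Lemma sub_cone (j j' : 'I_2) x y : j <= j' -> cone j' x y -> cone j x y.
Proof.
move=> jj /orP[/eqP->|/existsP[i /andP[ji xy]]]; first exact: cone_refl.
by apply/orP; right; apply/existsP; exists i; rewrite xy (leq_trans jj).
Qed.

End Frames.

(** * Soundness, and the extension property of projective formulas *)

Section Semantics.
Variable k : nat.
Implicit Types (M : model k) (A B : form k).

Lemma satE M (x : M) A : sat x A = bool_eval (sat x) A.
Proof. by elim: A => //= [A ->|A -> B ->|A -> B ->|A -> B ->]. Qed.

Lemma sat_BoxP M (x : M) i A :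
  reflect (forall y, R i x y -> sat y A) (sat x (Box i A)).
Proof. exact: (iffP forall_inP). Qed.

Lemma sat_ImpP M (x : M) A B :
  reflect (sat x A -> sat x B) (sat x (Imp A B)).
Proof. exact: implyP. Qed.

Lemma sat_Lob M i A (x : M) : sat x (Imp (Box i (Imp (Box i A) A)) (Box i A)).
Proof.
apply/sat_ImpP; move: x; apply: (finite_order_ind (@R_irr M i) (@R_trans M i)).
move=> x IH /sat_BoxP H; apply/sat_BoxP => y xy.
apply: (sat_ImpP _ _ _ (H y xy)); apply: (IH y xy); apply/sat_BoxP => z yz.
exact/H/(R_trans xy yz).
Qed.

Lemma J2_axiom_valid A : J2_axiom A -> forall M, valid_in M A.
Proof.
case=> [B tB|i B C|i B|m n B mn|m n B mn|B] M x.
- by rewrite satE.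
- apply/sat_ImpP=> /sat_BoxP BC; apply/sat_ImpP=> /sat_BoxP HB.
  by apply/sat_BoxP => y xy; apply: (sat_ImpP _ _ _ (BC y xy)); apply: HB.
- exact: sat_Lob.
- apply/sat_ImpP=> /sat_BoxP H; apply/sat_BoxP=> y xy; apply/sat_BoxP=> z yz.
  apply: H; case: (ord2P m) (ord2P n) mn xy yz => -> [] -> // _.
  + exact: R_trans.
  + exact: R10.
  + exact: R_trans.
- apply/sat_ImpP=> /sat_BoxP H; apply/sat_BoxP=> y xy; apply/sat_BoxP=> z yz.
  exact/H/(R_mn mn xy yz).
- apply/sat_ImpP=> H; apply/sat_BoxP => y xy; move: H.
  rewrite -[_ (Dia _ _)]/(~~ sat x (Box i0 (Neg B))).
  rewrite -[_ (Dia _ _)]/(~~ sat y (Box i0 (Neg B))).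
  apply: contra => /sat_BoxP H.
  by apply/sat_BoxP => z; move/(R1_R0 xy); apply: H.
Qed.

Lemma soundness (hyp : form k -> Prop) A M :
  J2_derives hyp A -> (forall B, hyp B -> valid_in M B) -> valid_in M A.
Proof.
move=> dA hM; elim: dA => {A} [A|A /J2_axiom_valid|A B _ AB _ HA x|i A _ HA x] //.
- exact: hM.
- exact: (sat_ImpP _ _ _ (AB x)).
- by apply/sat_BoxP.
Qed.

Lemma sat_gen M (x : M) (y : gen_submodel x) A : sat y A = sat (val y) A.
Proof.
elim: A y => //= [p|A IH|A IHA B IHB|A IHA B IHB|A IHA B IHB|i A IH] y.
- by rewrite inE.
- by rewrite IH.
- by rewrite IHA IHB.
- by rewrite IHA IHB.
- by rewrite IHA IHB.
apply/forall_inP/forall_inP => H z yz; last by rewrite IH; apply: H.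
have xz : connect (step (@R M)) x z.
  by apply: connect_trans (valP y) (connect1 _); apply/existsP; exists i.
by have := H (Sub z xz) yz; rewrite IH.
Qed.

Definition subst_model (s : substitution k) M : model k :=
  @Model k M (fun p => [set x | sat x (s p)]).

Lemma sat_subst s M (x : M) A :
  sat (x : subst_model s M) A = sat x (subst s A).
Proof.
elim: A x => //= [p|A IH|A IHA B IHB|A IHA B IHB|A IHA B IHB|i A IH] x.
- by rewrite inE.
- by rewrite IH.
- by rewrite IHA IHB.
- by rewrite IHA IHB.
- by rewrite IHA IHB.
by apply: eq_forallb => y; rewrite IH.
Qed.

Lemma sat_subst_id (s : substitution k) A (M : model k) (x : M) :
  (forall y p, connect (step (@R M)) x y -> sat y (s p) = (y \in val_of M p)) ->
  sat x (subst s A) = sat x A.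
Proof.
elim: A x => //= [p|A IH|A IHA B IHB|A IHA B IHB|A IHA B IHB|i A IH] x eqs.
- exact: eqs (connect0 _ x).
- by rewrite IH.
- by rewrite IHA ?IHB.
- by rewrite IHA ?IHB.
- by rewrite IHA ?IHB.
apply: eq_forallb => y; have [xy|//] := boolP (R i x y); rewrite IH // => z p yz.
apply: eqs; apply: connect_trans yz; apply: connect1.
by apply/existsP; exists i.
Qed.

Lemma sat_variant M (v : 'I_k -> {set M}) A (x : M) :
  (forall (x : M) p, x != root M -> (x \in v p) = (x \in val_of M p)) ->
  x != root M -> sat (x : Model v) A = sat x A.
Proof.
move=> eqv; elim: A x => //= [p|A IH|A IHA B IHB|A IHA B IHB|A IHA B IHB|i A IH] x xr.
- exact: eqv.
- by rewrite IH.
- by rewrite IHA ?IHB.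
- by rewrite IHA ?IHB.
- by rewrite IHA ?IHB.
apply: eq_forallb => y; have [xy|//] := boolP (R i x y).
rewrite IH //; apply: contraNneq (step_rootF x) => <-.
by apply/existsP; exists i.
Qed.

Lemma projective_extension A : projective A -> extension_property (MOD_S A).
Proof.
case=> s unif proj M HM; exists (subst_model s M); last first.
  by move=> x; rewrite sat_subst; apply: (soundness unif).
exists (fun p => [set x | sat x (s p)]) => // x p xr; rewrite inE.
(* Below a world other than the root [A] is valid, so by soundness [s p] and [p] agree there and the
   valuation is unchanged. *)
have hyp B : A = B -> valid_in (gen_submodel x) B by move=> <-; apply: HM.
have := soundness (proj p) hyp (gen_root x).
rewrite sat_gen /= => /andP[/implyP sp /implyP ps].
by apply/idP/idP.
Qed.

End Semantics.

(** * Boxed subformulas *)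

Section Boxes.
Variable k : nat.
Implicit Types A : form k.

Fixpoint boxes A : seq ('I_2 * form k) :=
  match A with
  | Var _ | Top | Bot => [::]
  | Neg B => boxes B
  | And B C | Or B C | Imp B C => boxes B ++ boxes C
  | Box i B => (i, B) :: boxes B
  end.

Lemma boxes_trans A b : b \in boxes A -> {subset b :: boxes b.2 <= boxes A}.
Proof.
elim: A => //= [A IHA B IHB|A IHA B IHB|A IHA B IHB|i A IHA];
  rewrite ?mem_cat ?inE.
1,2,3: by case/orP=> [/IHA|/IHB] H d /H; rewrite mem_cat => ->; rewrite ?orbT.
by case/orP=> [/eqP-> //|/IHA H d /H]; rewrite inE orbC => ->.
Qed.

Lemma eq_bool_eval A (a a' : form k -> bool) :
  (forall p, a (Var p) = a' (Var p)) ->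
  {in boxes A, forall b, a (Box b.1 b.2) = a' (Box b.1 b.2)} ->
  bool_eval a A = bool_eval a' A.
Proof.
move=> eqv; elim: A => //= [A IH|A IHA B IHB|A IHA B IHB|A IHA B IHB|i A _] eqb.
- by rewrite IH.
- by rewrite IHA ?IHB // => b Hb; apply: eqb; rewrite mem_cat Hb ?orbT.
- by rewrite IHA ?IHB // => b Hb; apply: eqb; rewrite mem_cat Hb ?orbT.
- by rewrite IHA ?IHB // => b Hb; apply: eqb; rewrite mem_cat Hb ?orbT.
exact: (eqb (i, A) (mem_head _ _)).
Qed.

End Boxes.

(** * Modalized fixed points *)

Section FixedPoints.
Variable k : nat.

(* An unknown [(j, psi)] stands for the truth value of [Box j psi] in the model
   being constructed. *)
Notation key := ('I_2 * form k)%type.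
Notation assignment := (key -> form k).
Implicit Types (Q : assignment) (C : key -> assignment -> form k) (b : key).

Definition upd b Q (A : form k) : assignment := fun c => if c == b then A else Q c.

Definition agree (j : 'I_2) (M : model k) (x : M) Q Q' : Prop :=
  forall y, cone j x y -> forall b, sat y (Q b) = sat y (Q' b).

(** Semantic form of the condition that the unknowns occur in [f] under no modality smaller than
    [j]. *)
Definition local (j : 'I_2) (f : assignment -> form k) : Prop :=
  forall (M : model k) (x : M) Q Q', agree j x Q Q' -> sat x (f Q) = sat x (f Q').

(* Solution of the single equation [X = Box j (C X)]: replace [X] by [Top]. *)
Definition solve1 C b Q : form k := Box b.1 (C b (upd b Q Top)).

(** Elimination with back-substitution: the solution for [b], still depending on the other unknowns,
    is put into their equations, and their solution then fixes the value at [b]. *)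
Fixpoint solve C (s : seq key) Q : assignment :=
  if s is b :: s' then
    let q := solve (fun c q => C c (upd b q (solve1 C b q))) s' Q in
    upd b q (solve1 C b q)
  else Q.

Lemma agree_sub (j j' : 'I_2) (M : model k) (x : M) Q Q' :
  j <= j' -> agree j x Q Q' -> agree j' x Q Q'.
Proof. by move=> jj H y xy; apply: H; apply: sub_cone xy. Qed.

Lemma local_sub (j j' : 'I_2) f : j <= j' -> local j' f -> local j f.
Proof. by move=> jj lf M x Q Q' H; apply: lf; apply: agree_sub H. Qed.

Lemma agree_R j (M : model k) (x y : M) Q Q' :
  R j x y -> agree j x Q Q' -> agree j y Q Q'.
Proof.
move=> xy H z yz; apply: H; apply/orP; right; apply/existsP; exists j.
by rewrite leqnn (R_cone xy yz).
Qed.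

Lemma agree_upd j (M : model k) (x : M) b Q Q' A A' :
  agree j x Q Q' -> (forall y, cone j x y -> sat y A = sat y A') ->
  agree j x (upd b Q A) (upd b Q' A').
Proof. by move=> H HA y xy c; rewrite /upd; case: eqP => _; [apply: HA | apply: H]. Qed.

(** Being boxed by [b.1], the solution for [b] depends on the other unknowns only locally, so
    substituting it keeps the remaining equations local. *)
Lemma solve1_agree C b (M : model k) (x y : M) Q Q' :
  local b.1 (C b) -> agree b.1 x Q Q' -> cone b.1 x y ->
  sat y (solve1 C b Q) = sat y (solve1 C b Q').
Proof.
move=> lC H xy; apply: eq_forallb => z; have [yz|//] := boolP (R _ y z).
apply: lC; apply: agree_upd => //; exact: agree_R (cone_R xy yz) H.
Qed.

Lemma solve1P C b Q (M : model k) (x : M) : local b.1 (C b) ->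
  sat x (solve1 C b Q) = sat x (Box b.1 (C b (upd b Q (solve1 C b Q)))).
Proof.
(* If the solution holds at [y], transitivity makes it hold on the cone of each successor of [y],
   where it may be exchanged with [Top]. *)
move=> lC; have eqC (y : M) : sat y (solve1 C b Q) ->
    forall z, R b.1 y z ->
    sat z (C b (upd b Q Top)) = sat z (C b (upd b Q (solve1 C b Q))).
  move/sat_BoxP=> Hy z yz; apply: lC; apply: agree_upd => // t zt.
  by apply/esym/sat_BoxP => u tu; apply: Hy; apply: R_trans yz (cone_R zt tu).
apply/idP/idP => [H|].
  by apply/sat_BoxP => y xy; rewrite -(eqC x) //; move/sat_BoxP: H; apply.
(* The right-hand side is inherited by successors, so by induction the solution holds at all of them
   and can again be exchanged with [Top]. *)
move: x; apply: (finite_order_ind (@R_irr M b.1) (@R_trans M b.1)) => x IH /sat_BoxP H.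
have Hy y : R b.1 x y -> sat y (solve1 C b Q).
  by move=> xy; apply: IH => //; apply/sat_BoxP => z yz; apply/H/(R_trans xy).
apply/sat_BoxP => y xy; rewrite (@lC _ _ _ (upd b Q (solve1 C b Q))) ?H //.
apply: agree_upd => // z yz; rewrite Hy //; exact: R_cone yz.
Qed.

(* Eliminating [b] puts the other unknowns under [Box b.1], so unknowns with
   larger modalities have to be eliminated first. *)
Lemma solveP C s Q (m : 'I_2) :
  uniq s -> path (fun j j' : 'I_2 => j' <= j) m (map fst s) ->
  (forall b, local m (C b)) ->
  forall b, b \in s -> forall (M : model k) (x : M),
  sat x (solve C s Q b) = sat x (Box b.1 (C b (solve C s Q))).
Proof.
elim: s C m => //= b s IHs C m /andP[bs us] /andP[bm ps] lC c.
have lCb d : local b.1 (C d) by apply: local_sub (lC d).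
set C' := fun d q => C d (upd b q (solve1 C b q)); set q := solve C' s Q.
rewrite inE; have [->|cb] /= := eqVneq c b => [_|cs] M x.
  by rewrite {1}/upd eqxx; apply: solve1P.
rewrite {1}/upd (negPf cb); apply: (IHs _ b.1) => // d N y Q1 Q2 H.
apply: (lCb d); apply: agree_upd => // z yz; exact: solve1_agree (lCb b) H yz.
Qed.

End FixedPoints.

(** * Construction of the projective unifier *)

Section Unifier.
Variable k : nat.
Implicit Types (A B : form k).

(** Shannon expansion, by which any Boolean function of the truth values of [L] is expressed as a
    formula. *)
Fixpoint bool_fun (f : seq bool -> bool) (L : seq (form k)) : form k :=
  if L is A :: L' then
    Or (And A (bool_fun (fun l => f (true :: l)) L'))
       (And (Neg A) (bool_fun (fun l => f (false :: l)) L'))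
  else if f [::] then Top else Bot.

Lemma sat_bool_fun f L (M : model k) (x : M) :
  sat x (bool_fun f L) = f (map (fun A => sat x A) L).
Proof.
elim: L f => [|A L IHL] f /=; first by case: f.
by rewrite !IHL; case: (sat x A); rewrite ?orbF.
Qed.

Variable phi : form k.

(** One box of each kind covers the whole generated submodel, since steps compose to steps. *)
Definition hereditary A : form k := And A (And (Box i0 A) (Box i1 A)).

Lemma sat_hereditary A (M : model k) (x : M) :
  sat x (hereditary A) = sat x A && [forall y, step (@R M) x y ==> sat y A].
Proof.
rewrite /=; congr andb; apply/andP/forall_inP => [[H0 H1] y /existsP[i]|H].
  by case: (ord2P i) => ->; [apply: (forall_inP H0) | apply: (forall_inP H1)].
by split; apply/forall_inP => y xy; apply: H; apply/existsP; [exists i0 | exists i1].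
Qed.

(** Puts the boxes by [i1] first, the elimination order required by [solveP]. *)
Definition modality_ge : rel ('I_2 * form k) := fun b c => c.1 <= b.1.

Definition keys : seq ('I_2 * form k) := sort modality_ge (undup (boxes phi)).

Definition atom_values (a : {ffun 'I_k -> bool}) (l : seq bool) A : bool :=
  match A with
  | Var p => a p
  | Box i B => nth false l (index (i, B) keys)
  | _ => false
  end.

(** The choice depends on [l] alone, hence is a Boolean function of the box values that [bool_fun]
    can express. The default covers those [l] for which no valuation works. *)
Definition good_values (l : seq bool) : {ffun 'I_k -> bool} :=
  odflt [ffun=> false] [pick a | bool_eval (atom_values a l) phi].

Definition new_var (Q : 'I_2 * form k -> form k) (p : 'I_k) : form k :=
  Or (And (hereditary phi) (Var p))
     (And (Neg (hereditary phi)) (bool_fun (fun l => good_values l p) (map Q keys))).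

Lemma sat_new_var Q p (M : model k) (x : M) :
  sat x (new_var Q p) = if sat x (hereditary phi) then x \in val_of M p
                        else good_values [seq sat x (Q b) | b <- keys] p.
Proof.
rewrite /new_var; move: (hereditary phi) => h; rewrite /= sat_bool_fun -map_comp.
by case: (sat x h); rewrite ?orbF.
Qed.

Fixpoint trans (Q : 'I_2 * form k -> form k) A : form k :=
  match A with
  | Var p => new_var Q p
  | Top => Top
  | Bot => Bot
  | Neg B => Neg (trans Q B)
  | And B C => And (trans Q B) (trans Q C)
  | Or B C => Or (trans Q B) (trans Q C)
  | Imp B C => Imp (trans Q B) (trans Q C)
  | Box i B => Q (i, B)
  end.

(** No unknown lies under a modality in a translation, so only the values at [x] matter, whatever
    [j] is. *)
Lemma trans_local A j : local j (fun Q => trans Q A).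
Proof.
move=> M x Q Q' /(_ x (cone_refl j x)) H.
elim: A => //= [p|A ->|A -> B ->|A -> B ->|A -> B ->] //.
by rewrite -![_ || _]/(sat x (new_var _ p)) !sat_new_var (eq_map H).
Qed.

Definition box_values : 'I_2 * form k -> form k :=
  solve (fun b Q => trans Q b.2) keys (fun=> Top).

Definition projector : substitution k := new_var box_values.

Lemma box_valuesP b (M : model k) (x : M) : b \in keys ->
  sat x (box_values b) = sat x (Box b.1 (trans box_values b.2)).
Proof.
move=> bk; apply: (@solveP _ _ _ _ i1) => // [||c].
- by rewrite sort_uniq undup_uniq.
- have: sorted modality_ge keys.
    by apply: sort_sorted => c d; apply: leq_total.
  case: keys => //= c s; rewrite path_map => ->; rewrite andbT.
  by rewrite -ltnS.
- exact: trans_local.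
Qed.

Lemma mem_keys b : (b \in keys) = (b \in boxes phi).
Proof. by rewrite mem_sort mem_undup. Qed.

(** The box case is the fixed-point equation [box_valuesP]. *)
Lemma sat_projector A (M : model k) (x : M) :
  {subset boxes A <= boxes phi} ->
  sat x (subst projector A) = sat x (trans box_values A).
Proof.
elim: A x => //= [A IH|A IHA B IHB|A IHA B IHB|A IHA B IHB|i A IH] x sub.
- by rewrite IH.
- by rewrite IHA ?IHB // => b Hb; apply: sub; rewrite mem_cat Hb ?orbT.
- by rewrite IHA ?IHB // => b Hb; apply: sub; rewrite mem_cat Hb ?orbT.
- by rewrite IHA ?IHB // => b Hb; apply: sub; rewrite mem_cat Hb ?orbT.
rewrite box_valuesP ?mem_keys ?sub ?mem_head //=.
apply: eq_forallb => y; rewrite IH // => b Hb; apply: sub.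
by rewrite inE Hb orbT.
Qed.

Lemma sat_box_values b (M : model k) (x : M) : b \in keys ->
  sat x (box_values b) = sat x (subst projector (Box b.1 b.2)).
Proof.
case: b => i A bk; rewrite sat_projector //= => c.
by move: bk; rewrite mem_keys => /boxes_trans; apply.
Qed.

Lemma projector_fixes (M : model k) (x : M) p :
  sat x (hereditary phi) -> sat x (projector p) = (x \in val_of M p).
Proof. by rewrite sat_new_var => ->. Qed.

Lemma good_valuesP a l :
  bool_eval (atom_values a l) phi -> bool_eval (atom_values (good_values l) l) phi.
Proof. by rewrite /good_values; case: pickP => //= ->. Qed.

Lemma projector_unifies : extension_property (MOD_S phi) ->
  forall (M : model k) (x : M), sat x (subst projector phi).
Proof.
move=> ext M; apply: (finite_order_ind (@step_irr M) (@step_trans M)) => x IH.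
(* Where [phi] holds hereditarily, the projector fixes the variables throughout the generated
   submodel. *)
have [hx|nhx] := boolP (sat x (hereditary phi)).
  rewrite sat_subst_id; first by move: hx; rewrite sat_hereditary => /andP[].
  move=> y p xy.
  apply: projector_fixes; move: xy; rewrite connect_stepE.
  case/orP=> [/eqP<- //|xy]; move: hx.
  rewrite !sat_hereditary => /andP[_ /forall_inP hx].
  rewrite hx //; apply/forall_inP => z yz; apply: hx; exact: step_trans xy yz.
(* Otherwise the substituted model generated by [x] satisfies [phi] off its root by induction, and
   the extension property supplies a variant satisfying it at the root too. *)
set N := gen_submodel (x : subst_model projector M).
have satN (y : N) A : sat y A = @sat k M (val y) (subst projector A).
  rewrite -sat_subst; exact: (@sat_gen k (subst_model projector M) x y A).
have [|N' [v eqv ->] HN'] := ext N.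
  move=> y yr z; rewrite sat_gen satN; apply: IH.
  have xy := valP y; rewrite connect_stepE in xy.
  case/orP: xy => [xy|xy]; first by case/eqP: yr; apply: val_inj; apply/esym/eqP.
  have := valP z; rewrite connect_stepE => /orP[/eqP <- //|].
  by case/existsP=> i yz; apply: step_trans xy _; apply/existsP; exists i.
(* The root valuation of the variant shows that some choice works; [good_values] may pick another
   one. *)
pose a := [ffun p => root N \in v p].
(* The root is nobody's successor, so the variant keeps the values of boxes there. *)
have boxN i B : sat (root N : Model v) (Box i B) = sat x (subst projector (Box i B)).
  rewrite -(satN (root N)); apply: eq_forallb => y.
  have [ry|//] := boolP (R i (root N) y); rewrite !implyTb.
  apply: (@sat_variant k N v B y eqv); apply: contraNneq (step_rootF (root N)) => {2}<-.
  by apply/existsP; exists i.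
pose l := [seq sat x (box_values b) | b <- keys].
have boxl b c : b \in boxes phi ->
    atom_values c l (Box b.1 b.2) = sat x (subst projector (Box b.1 b.2)).
  rewrite -mem_keys => bk; rewrite -sat_box_values //= -surjective_pairing.
  by rewrite (nth_map b) ?index_mem // nth_index.
have goodl : bool_eval (atom_values (good_values l) l) phi.
  apply: (@good_valuesP a); have := HN' (root N); rewrite satE.
  rewrite (@eq_bool_eval _ _ _ (atom_values a l)) // => [p|b Hb].
    by rewrite /= ffunE.
  by rewrite boxl // -boxN.
rewrite -sat_subst satE (@eq_bool_eval _ _ _ (atom_values (good_values l) l)) //.
  by move=> p; rewrite [LHS]inE sat_new_var (negPf nhx).
by move=> b Hb; rewrite boxl // sat_subst.
Qed.

End Unifier.

(** * Completeness for finite stratified models *)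

Section Derivations.
Variables (k : nat) (hyp : form k -> Prop).
Implicit Types (A B C : form k) (L : seq (form k)).
Local Notation "|- A" := (J2_derives hyp A) (at level 95).

Lemma derives_taut1 A B : (forall a, bool_eval a A -> bool_eval a B) -> (|- A) -> |- B.
Proof.
by move=> AB; apply: d_mp; apply/d_ax/ax_taut => a /=; apply/implyP; apply: AB.
Qed.

Lemma derives_taut2 A B C :
  (forall a, bool_eval a A -> bool_eval a B -> bool_eval a C) ->
  (|- A) -> (|- B) -> |- C.
Proof.
move=> ABC dA; apply: d_mp; apply: derives_taut1 dA => a HA /=.
by apply/implyP; apply: ABC.
Qed.

Definition conj L : form k := foldr (@And k) Top L.

Lemma bool_eval_conj a L : bool_eval a (conj L) = all (bool_eval a) L.
Proof. by elim: L => //= A L ->. Qed.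

Lemma derives_conj L : (forall A, A \in L -> |- A) -> |- conj L.
Proof.
elim: L => [|A L IHL] H; first exact/d_ax/ax_taut.
apply: derives_taut2 (H A (mem_head _ _)) (IHL _) => [a /= -> //|B BL].
by apply: H; rewrite inE BL orbT.
Qed.

Lemma derives_trans A B C : (|- Imp A B) -> (|- Imp B C) -> |- Imp A C.
Proof.
by apply: derives_taut2 => a /= /implyP AB /implyP BC; apply/implyP => /AB/BC.
Qed.

Lemma derives_contra A B : (|- Imp A B) -> |- Imp (Neg B) (Neg A).
Proof. by apply: derives_taut1 => a /= /implyP AB; apply/implyP; apply: contra. Qed.

Lemma derives_box_mono i A B : (|- Imp A B) -> |- Imp (Box i A) (Box i B).
Proof. by move/(d_nec i); apply: d_mp; apply/d_ax/ax_K. Qed.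

Lemma derives_box_and i C A B :
  (|- Imp C (Box i A)) -> (|- Imp C (Box i B)) -> |- Imp C (Box i (And A B)).
Proof.
move=> CA; have: |- Imp (Box i A) (Box i (Imp B (And A B))).
  by apply/derives_box_mono/d_ax/ax_taut => a /=; do 2 case: bool_eval.
move/(derives_trans CA)/derives_trans/(_ (d_ax _ (ax_K i _ _))).
apply: derives_taut2 => a /=.
by case: bool_eval => //= /implyP H /H.
Qed.

Lemma derives_box_conj i C L :
  (forall A, A \in L -> |- Imp C (Box i A)) -> |- Imp C (Box i (conj L)).
Proof.
elim: L => [|A L IHL] H /=.
  have: |- Box i Top by apply/d_nec/d_ax/ax_taut.
  by apply: derives_taut1 => a /= ->; rewrite implybT.
apply: derives_box_and; first by apply: H; rewrite mem_head.
by apply: IHL => B BL; apply: H; rewrite inE BL orbT.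
Qed.

(** This is [ax_dia] for [Neg A], with the double negation under [Box i0] removed. *)
Lemma derives_box1_neg_box0 A : |- Imp (Neg (Box i0 A)) (Box i1 (Neg (Box i0 A))).
Proof.
have NN : |- Imp (Box i0 (Neg (Neg A))) (Box i0 A).
  by apply/derives_box_mono/d_ax/ax_taut => a /=; case: bool_eval.
have NI : |- Imp (Box i0 A) (Box i0 (Neg (Neg A))).
  by apply/derives_box_mono/d_ax/ax_taut => a /=; case: bool_eval.
apply: derives_trans (derives_contra NN) _.
apply: derives_trans (d_ax _ (ax_dia (Neg A))) _.
exact/derives_box_mono/derives_contra.
Qed.

End Derivations.

(** * Stratification by copying planes *)

Section Stratification.
Variables (T : finType) (S : 'I_2 -> rel T) (r : T).
Hypothesis S_irr : forall i, irreflexive (S i).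
Hypothesis S_trans : forall i, transitive (S i).
Hypothesis S10 : forall x y, S i1 x y -> S i0 x =1 S i0 y.
Hypothesis S01 : forall y x z, S i0 x y -> S i1 y z -> S i0 x z.

(* A pair [(x, w)] is the copy of the world [w] in the plane with root [x]. *)
Definition strat_world : finType :=
  {p : T * T | ((p.1 == p.2) || S i1 p.1 p.2) && ((p.1 == r) || S i0 r p.1)}.

(** Since [strat_R i0] compares only plane roots, the worlds of a plane share their
    [i0]-predecessors, which gives [R_strat]. *)
Definition strat_R (i : 'I_2) : rel strat_world := fun p q =>
  if i == i0 then S i0 (val p).1 (val q).1
  else ((val p).1 == (val q).1) && S i1 (val p).2 (val q).2.

Lemma strat_root_proof :
  (((r, r).1 == (r, r).2) || S i1 (r, r).1 (r, r).2) &&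
  (((r, r).1 == r) || S i0 r (r, r).1).
Proof. by rewrite /= !eqxx. Qed.

Definition strat_root : strat_world := Sub (r, r) strat_root_proof.

Lemma strat_irr i : irreflexive (@strat_R i).
Proof. by move=> p; rewrite /strat_R !S_irr andbF; case: eqP. Qed.

Lemma strat_trans i : transitive (@strat_R i).
Proof.
move=> q p t; rewrite /strat_R; case: (i == i0); first exact: S_trans.
case/andP=> /eqP-> pq /andP[/eqP-> qt]; rewrite eqxx; exact: S_trans pq qt.
Qed.

Lemma strat_R1_R0 p q : strat_R i1 p q -> forall t, strat_R i0 p t <-> strat_R i0 q t.
Proof. by case/andP=> /eqP pq _ t; rewrite /strat_R /= pq. Qed.

Lemma strat_R_mn (m n : 'I_2) p q t :
  m <= n -> strat_R m p q -> strat_R n q t -> strat_R m p t.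
Proof.
case: (ord2P m) (ord2P n) => -> [] -> //= _; try exact: strat_trans.
by rewrite /strat_R /= => pq /andP[/eqP<-].
Qed.

Lemma strat_R_strat p q t : strat_R i0 t p -> strat_R i1 q p -> strat_R i0 t q.
Proof. by rewrite /strat_R /= => tp /andP[/eqP->]. Qed.

Lemma strat_root_gen p : connect (step strat_R) strat_root p.
Proof.
have [->|pr] := eqVneq p strat_root; first exact: connect0.
apply/connect1/existsP; case: p pr => -[x w] /= xw.
have /andP[/= xw' /orP[/eqP xr|rx]] := xw => pr; last by exists i0.
exists i1; rewrite /strat_R /= xr eqxx /=; move: xw'; rewrite xr.
case/orP=> // /eqP rw; case/eqP: pr; apply: val_inj => /=; by rewrite xr -rw.
Qed.

Definition strat_frame : frame :=
  Frame strat_irr strat_trans strat_R1_R0 strat_R_mn strat_R_strat strat_root_gen.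

(** Together with [strat_back], makes the second projection a bounded morphism. [S10] moves the
    source from its plane root to the world itself, and [S01] the target. *)
Lemma strat_forth i (p q : strat_frame) : R i p q -> S i (val p).2 (val q).2.
Proof.
case: (ord2P i) => -> /=; last by case/andP.
case/andP: (valP p) (valP q) => /= /orP pp _ /andP[/orP qq _].
rewrite /strat_R /= => pq; have {}pq : S i0 (val p).2 (val q).1.
  by case: pp => [/eqP<-|/S10<-].
by case: qq => [/eqP<-|/(S01 pq)].
Qed.

(** An [S i0]-successor [y] is matched by the root [(y, y)] of its own plane, an [S i1]-successor by
    its copy in the plane of [p]. *)
Lemma strat_back i (p : strat_frame) y :
  S i (val p).2 y -> exists2 q : strat_frame, R i p q & (val q).2 = y.
Proof.
case: p => -[x w] /= xw; have /andP[/= /orP pp pr] := xw.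
case: (ord2P i) => -> wy.
  have {wy} xy : S i0 x y by case: pp => [/eqP->|/S10->].
  have q_ok : ((y == y) || S i1 y y) && ((y == r) || S i0 r y).
    rewrite eqxx /= orbC; case/orP: pr => [/eqP<-|/S_trans->//]; first by rewrite xy.
  by exists (exist _ (y, y) q_ok).
have q_ok : ((x == y) || S i1 x y) && ((x == r) || S i0 r x).
  rewrite pr andbT orbC; case: pp => [/eqP->|/S_trans->//]; by rewrite wy.
by exists (exist _ (x, y) q_ok); rewrite //= /strat_R /= eqxx.
Qed.

Lemma sat_strat k (a : T -> form k -> bool) (A : form k) :
  let M := @Model k strat_frame (fun p => [set q | a (val q).2 (Var p)]) in
  (forall b x, b \in boxes A ->
     a x (Box b.1 b.2) = [forall y, S b.1 x y ==> bool_eval (a y) b.2]) ->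
  forall x : M, sat x A = bool_eval (a (val x).2) A.
Proof.
move=> M; elim: A => //= [p|A IH|A IHA B IHB|A IHA B IHB|A IHA B IHB|i A IH] H x.
- by rewrite inE.
- by rewrite IH.
- by rewrite IHA ?IHB // => b y Hb; apply: H; rewrite mem_cat Hb ?orbT.
- by rewrite IHA ?IHB // => b y Hb; apply: H; rewrite mem_cat Hb ?orbT.
- by rewrite IHA ?IHB // => b y Hb; apply: H; rewrite mem_cat Hb ?orbT.
rewrite (H (i, A) _ (mem_head _ _)) /=.
have {}IH (y : M) : sat y A = bool_eval (a (val y).2) A.
  by apply: IH => b z Hb; apply: H; rewrite inE Hb orbT.
apply/forall_inP/forall_inP => Hx y xy.
  by have [q xq <-] := strat_back xy; rewrite -IH; apply: Hx.
by rewrite IH; apply/Hx/strat_forth.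
Qed.

End Stratification.

(** * The finite canonical model *)

Section Completeness.
Variables (k : nat) (A0 : form k).
Implicit Types A B : form k.

Definition bodies : seq (form k) := undup (map snd (boxes A0)).

(** Both boxes over each body are included, because the step conditions for either modality involve
    both. *)
Definition atoms : seq (form k) :=
  map (@Var k) (enum 'I_k) ++ [seq Box i B | i <- enum 'I_2, B <- bodies].

Notation world0 := ((size atoms).-tuple bool).

Definition asg (w : world0) A : bool := nth false w (index A atoms).

Definition chi (w : world0) : form k :=
  conj [seq if asg w A then A else Neg A | A <- atoms].

Definition tame A := all (fun b => b.2 \in bodies) (boxes A).

Lemma Var_atoms p : Var p \in atoms.
Proof. by rewrite mem_cat map_f ?mem_enum. Qed.

Lemma Box_atoms i B : B \in bodies -> Box i B \in atoms.
Proof.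
by move=> Bs; rewrite mem_cat orbC (@allpairs_f _ _ _ (@Box k)) ?mem_enum.
Qed.

Lemma atoms_eval a A : A \in atoms -> bool_eval a A = a A.
Proof.
by rewrite mem_cat => /orP[/mapP[p _ ->]|/allpairsP[[i B] [_ _ ->]]].
Qed.

Lemma chi_eval a w : bool_eval a (chi w) -> {in atoms, a =1 asg w}.
Proof.
rewrite bool_eval_conj all_map => /allP H A AA; have := H A AA.
by rewrite /= -(atoms_eval a AA); case: (asg w A) => //= /negPf.
Qed.

Lemma chi_tame a w A : tame A -> bool_eval a (chi w) ->
  bool_eval a A = bool_eval (asg w) A.
Proof.
move=> /allP tA /chi_eval H; apply: eq_bool_eval => [p|b /tA Hb].
  exact/H/Var_atoms.
exact/H/Box_atoms.
Qed.

Lemma chi_exists a : exists w, bool_eval a (chi w).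
Proof.
have sz : size (map a atoms) == size atoms by rewrite size_map.
exists (Tuple sz); rewrite bool_eval_conj all_map; apply/allP => A AA /=.
have -> : asg (Tuple sz) A = a A.
  by rewrite /asg /= (nth_map A) ?index_mem // nth_index.
by case E: (a A) => /=; rewrite atoms_eval // E.
Qed.

(** The disjunction of all [chi w] is a tautology. *)
Lemma chi_theorem A : (forall w, J2_theorem (Imp (chi w) A)) -> J2_theorem A.
Proof.
move=> H; have: J2_theorem (conj [seq Imp (chi w) A | w <- enum {: world0}]).
  by apply: derives_conj => B /mapP[w _ ->]; apply: H.
apply: derives_taut1 => a; rewrite bool_eval_conj all_map => /allP Ha.
have [w aw] := chi_exists a.
by have := Ha w (mem_enum _ _) => /=; rewrite aw.
Qed.

Definition consistent (w : world0) : bool := `[< ~ J2_theorem (Neg (chi w)) >].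

(* [step_form i w B] says of an [R i]-successor of [w] that it respects the
   values in [w] of the boxes over [B]. *)
Definition step_form (i : 'I_2) (w : world0) B : form k :=
  if i == i0 then
    if asg w (Box i0 B) then And B (And (Box i0 B) (Box i1 B)) else Top
  else
    And (if asg w (Box i1 B) then And B (Box i1 B) else Top)
        (if asg w (Box i0 B) then Box i0 B else Neg (Box i0 B)).

Definition succ_form (i : 'I_2) (w : world0) : form k :=
  conj [seq step_form i w B | B <- bodies].

(** The second conjunct, that some box becomes true along the step, gives irreflexivity. *)
Definition can_R (i : 'I_2) : rel world0 := fun w y =>
  bool_eval (asg y) (succ_form i w) &&
  has (fun B => asg y (Box i B) && ~~ asg w (Box i B)) bodies.

Lemma chi_lit w A : A \in atoms ->
  J2_theorem (Imp (chi w) (if asg w A then A else Neg A)).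
Proof.
move=> AA; apply/d_ax/ax_taut => a /=; apply/implyP => /chi_eval H.
by case E: (asg w A) => /=; rewrite atoms_eval // H ?E.
Qed.

(** True boxes persist by [ax_box_nm] and [ax_box_mn], false [i0]-boxes persist along [i1] by
    [ax_dia]. *)
Lemma chi_box_succ i w : J2_theorem (Imp (chi w) (Box i (succ_form i w))).
Proof.
apply: derives_box_conj => _ /mapP[B Bs ->]; rewrite /step_form.
have top j : J2_theorem (Imp (chi w) (Box j Top)).
  have: J2_theorem (Box j (@Top k)) by apply/d_nec/d_ax/ax_taut.
  by apply: derives_taut1 => a /= ->; rewrite implybT.
have lit j := chi_lit w (Box_atoms j Bs).
have up (j m n : 'I_2) :
    asg w (Box j B) -> J2_axiom (Imp (Box j B) (Box m (Box n B))) ->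
    J2_theorem (Imp (chi w) (Box m (Box n B))).
  by move=> wB ax; have := lit j; rewrite wB => /derives_trans; apply; apply: d_ax.
case: (ord2P i) => -> /=.
  have := lit i0; case: ifP => wB litB; last exact: top.
  apply: derives_box_and => //; apply: derives_box_and; apply: (up i0) => //.
    exact: ax_box_nm.
  exact: ax_box_mn.
apply: derives_box_and.
  have := lit i1; case: ifP => wB litB; last exact: top.
  apply: derives_box_and => //; apply: (up i1) => //; exact: ax_box_nm.
have := lit i0; case: ifP => wB litB; first by apply: (up i0) => //; exact: ax_box_nm.
exact: derives_trans litB (derives_box1_neg_box0 _ _).
Qed.

Lemma bodies_tame i B : B \in bodies -> tame (Box i B).
Proof.
move=> Bs; rewrite /tame /= Bs /=; apply/allP => c cB.
move: Bs; rewrite !mem_undup => /mapP[b bA eB]; apply: map_f.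
by apply: (boxes_trans bA); rewrite inE -eB cB orbT.
Qed.

Lemma conj_tame L : {in L, forall A, tame A} -> tame (conj L).
Proof.
elim: L => // A L IHL H; rewrite /tame /= all_cat; apply/andP; split.
  by apply: H; rewrite mem_head.
by apply: IHL => B BL; apply: H; rewrite inE BL orbT.
Qed.

Lemma succ_tame i w : tame (succ_form i w).
Proof.
apply: conj_tame => _ /mapP[B Bs ->].
have tB : tame B by case/andP: (bodies_tame i0 Bs).
case: (ord2P i) => ->; rewrite /step_form /tame /= in tB *.
  by case: ifP => _ /=; rewrite ?all_cat /= ?all_cat /= ?Bs ?tB.
rewrite all_cat; case: (asg w _); case: (asg w _) => /=;
  by rewrite ?all_cat /= ?Bs ?tB.
Qed.

(** Without such a [y], [succ_form i w] would imply [Box i B -> B]; by [chi_box_succ] and [ax_Lob],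
    [chi w] would then imply [Box i B], against consistency. *)
Lemma can_R_exists i w B : consistent w -> B \in bodies -> ~~ asg w (Box i B) ->
  exists y, [/\ consistent y, can_R i w y & ~~ bool_eval (asg y) B].
Proof.
move=> /asboolP cw Bs wB; apply: contrapT => noy; apply: cw.
have: J2_theorem (Imp (succ_form i w) (Imp (Box i B) B)).
  apply: chi_theorem => y; have [cy|] := boolP (consistent y); last first.
    move/asboolPn/contrapT; apply: derives_taut1 => a /= /negPf ->.
    by rewrite implyFb.
  apply/d_ax/ax_taut => a /=; apply/implyP => ay.
  have /andP[_ tB] := bodies_tame i Bs.
  rewrite (chi_tame (succ_tame i w) ay) (chi_tame tB ay).
  rewrite (chi_eval ay (Box_atoms i Bs)).
  apply/implyP => yw; apply/implyP => yB; apply: contrapT => /negP nyB; apply: noy.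
  exists y; split=> //; apply/andP; split=> //.
  by apply/hasP; exists B => //; rewrite yB.
move/(derives_box_mono i)/(derives_trans (chi_box_succ i w)).
move/derives_trans/(_ (d_ax _ (ax_Lob i B))).
have := chi_lit w (Box_atoms i Bs); rewrite (negPf wB).
apply: derives_taut2 => a /=; case: (bool_eval a (chi w)) => //=; by case: (a _).
Qed.

Lemma can_R0P w y : reflect
  ({in bodies, forall B, asg w (Box i0 B) ->
      [/\ bool_eval (asg y) B, asg y (Box i0 B) & asg y (Box i1 B)]} /\
   exists2 B, B \in bodies & asg y (Box i0 B) && ~~ asg w (Box i0 B))
  (can_R i0 w y).
Proof.
apply: (iffP andP) => -[H /hasP yw]; split=> //.
- move=> B Bs wB; move: H; rewrite bool_eval_conj all_map => /allP/(_ B Bs) /=.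
  by rewrite /step_form /= wB => /and3P.
- rewrite bool_eval_conj all_map; apply/allP => B Bs /=; rewrite /step_form /=.
  by case: ifP => // wB; have /and3P := H B Bs wB.
Qed.

Lemma can_R1P w y : reflect
  ([/\ {in bodies, forall B, asg w (Box i1 B) ->
      bool_eval (asg y) B /\ asg y (Box i1 B)},
       {in bodies, forall B, asg w (Box i0 B) = asg y (Box i0 B)} &
   exists2 B, B \in bodies & asg y (Box i1 B) && ~~ asg w (Box i1 B)])
  (can_R i1 w y).
Proof.
apply: (iffP andP) => [[H /hasP yw]|[H1 H0 yw]]; split=> //; last exact/hasP.
- move=> B Bs wB; move: H; rewrite bool_eval_conj all_map => /allP/(_ B Bs) /=.
  by rewrite /step_form /= wB => /andP[/andP].
- move=> B Bs; move: H; rewrite bool_eval_conj all_map => /allP/(_ B Bs) /=.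
  by rewrite /step_form /= => /andP[_]; case: (asg w _) => /= [->|/negPf].
rewrite bool_eval_conj all_map; apply/allP => B Bs /=; rewrite /step_form /=.
apply/andP; split; first by case: ifP => // /(H1 B Bs)/andP.
by rewrite H0 //; case: ifP => //= ->.
Qed.

Lemma can_irr i : irreflexive (can_R i).
Proof. by move=> w; apply/negP => /andP[_ /hasP[B _]]; rewrite andbN. Qed.

Lemma can10 w y : can_R i1 w y -> can_R i0 w =1 can_R i0 y.
Proof.
case/can_R1P => _ H0 _ z; apply/can_R0P/can_R0P => -[H [C Cs zC]]; split.
- by move=> B Bs; rewrite -H0 //; apply: H.
- by exists C; rewrite // -H0.
- by move=> B Bs; rewrite H0 //; apply: H.
- by exists C; rewrite // H0.
Qed.

Lemma can01 y w z : can_R i0 w y -> can_R i1 y z -> can_R i0 w z.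
Proof.
move=> /can_R0P[H [C Cs yC]] /can_R1P[H1 H0 _]; apply/can_R0P; split.
  move=> B Bs /(H B Bs)[_ y0 y1]; have [zB z1] := H1 B Bs y1.
  by split; rewrite -?H0.
by exists C; rewrite -?H0.
Qed.

Lemma can_trans i : transitive (can_R i).
Proof.
move=> y w z; case: (ord2P i) => ->.
  move=> /can_R0P[H [C Cs /andP[yC wC]]] /can_R0P[K _]; apply/can_R0P; split.
    by move=> B Bs /(H B Bs)[_ y0 _]; apply: K.
  by exists C; rewrite // wC; have [_ -> _] := K C Cs yC.
move=> /can_R1P[H H0 [C Cs /andP[yC wC]]] /can_R1P[K K0 _]; apply/can_R1P; split.
- by move=> B Bs /(H B Bs)[_ y1]; apply: K.
- by move=> B Bs; rewrite H0 ?K0.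
by exists C; rewrite // wC; have [_ ->] := K C Cs yC.
Qed.

Lemma can_R_sat i w y B : can_R i w y -> B \in bodies -> asg w (Box i B) ->
  bool_eval (asg y) B.
Proof.
case: (ord2P i) => ->.
  by case/can_R0P=> H _ Bs /(H B Bs) [].
by case/can_R1P=> H _ _ Bs /(H B Bs) [].
Qed.

Definition can_world : finType := {w : world0 | consistent w}.

Definition can_rel i : rel can_world := fun w y => can_R i (val w) (val y).

Lemma asg_box i (w : can_world) B : B \in bodies ->
  asg (val w) (Box i B) = [forall y, can_rel i w y ==> bool_eval (asg (val y)) B].
Proof.
move=> Bs; apply/idP/forall_inP => [wB y wy|H]; first exact: can_R_sat wy Bs wB.
apply: contraT => /(can_R_exists (valP w) Bs)[y [cy wy]].
by rewrite (H (Sub y cy)).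
Qed.

Lemma completeness : (forall (M : model k) (x : M), sat x A0) -> J2_theorem A0.
Proof.
move=> valid; apply: chi_theorem => w.
have [cw|] := boolP (consistent w); last first.
  by move/asboolPn/contrapT; apply: derives_taut1 => a /= /negPf ->.
apply/d_ax/ax_taut => a /=; apply/implyP => aw.
rewrite (chi_tame _ aw); last by apply/allP => b bA; rewrite mem_undup map_f.
have irr i : irreflexive (@can_rel i) by move=> x; apply: can_irr.
have tr i : transitive (@can_rel i) by move=> y x z; apply: can_trans.
have c10 x y : can_rel i1 x y -> can_rel i0 x =1 can_rel i0 y.
  by move=> xy z; apply: can10.
have c01 y x z : can_rel i0 x y -> can_rel i1 y z -> can_rel i0 x z by apply: can01.
pose r : can_world := Sub w cw.
(* The root of the stratified frame is a copy of [w], so the value of [A0] under [asg w] is its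
   truth at that root. *)
rewrite -[w]/(val (val (strat_root can_rel r)).2).
rewrite -(@sat_strat _ _ r irr tr c10 c01 k (fun x => asg (val x))); first exact: valid.
by move=> b x bA; apply: asg_box; rewrite mem_undup map_f.
Qed.

End Completeness.

(** * The characterization of projectivity *)

Lemma J2_theorem_derives k (hyp : form k -> Prop) A :
  J2_theorem A -> J2_derives hyp A.
Proof.
rewrite /J2_theorem => dA; elim: dA => {A} [//|A ax|A B _ AB _ dA|i A _ dA].
- exact: d_ax.
- exact: d_mp dA.
- exact: d_nec.
Qed.

Theorem theorem3 (k : nat) (phi : form k) :
  projective phi <-> extension_property (MOD_S phi).
Proof.
split; first exact: projective_extension.
move=> ext; exists (projector phi) => [|p].
  by apply: completeness => M x; apply: projector_unifies.
have dphi : J2_entails phi phi by apply: d_hyp.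
(* Necessitation of the hypothesis yields [hereditary phi], which provably makes the projector fix
   each variable. *)
have dher : J2_entails phi (hereditary phi).
  have dbox i : J2_entails phi (Box i phi) by apply: d_nec.
  have dboxes : J2_entails phi (And (Box i0 phi) (Box i1 phi)).
    by apply: derives_taut2 (dbox i0) (dbox i1) => a /= ->.
  by apply: derives_taut2 dphi dboxes => a /= ->.
apply: d_mp dher; apply: J2_theorem_derives; apply: completeness => M x.
apply/sat_ImpP => /(projector_fixes p).
by move: (projector phi p) => A /= ->; rewrite implybb.
Qed.
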